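(* Let $\mathbf{c}=(c_n)_{n\ge1}$ be an oscillating sequence of complex numbers satisfying the growth condition $\sum_{n=1}^N|c_n|^\lambda=O(N)$ for some $\lambda>1$. Then $\mathbf{c}$ is linearly disjoint from every equicontinuous flow $\mathcal{X}=(X,T)$.
   Context: A flow $(X,T)$ is a compact metric space $(X,d)$ with a continuous map $T:X\to X$. It is equicontinuous if for every $\epsilon>0$ there is $\delta>0$ such that $d(x,y)<\delta$ implies $d(T^nx,T^ny)<\epsilon$ for all $n\ge0$. A sequence $(c_n)_{n\ge1}$ of complex numbers is oscillating if $\lim_{N\to\infty}\frac1N\sum_{n=1}^N c_n e^{-2\pi i n t}=0$ for every $t\in[0,1)$. It is linearly disjoint from $(X,T)$ if $\lim_{N\to\infty}\frac1N\sum_{n=1}^N c_n f(T^n x)=0$ for every continuous $f:X\to\mathbb{C}$ and every $x\in X$. *)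

(* Defs.v *)
From HB Require Import structures.
From mathcomp Require Import all_boot all_order all_algebra.
From mathcomp Require Import all_classical all_reals all_analysis.
From mathcomp Require Import complex.

Set Implicit Arguments.
Unset Strict Implicit.
Unset Printing Implicit Defensive.

Import Order.TTheory GRing.Theory Num.Theory.
Import numFieldTopology.Exports numFieldNormedType.Exports.

Local Open Scope classical_set_scope.
Local Open Scope ring_scope.
Local Open Scope complex_scope.

(* The instances giving a numFieldType the topology of its norm are keyed on
   variable structures, hence not found on the concrete carrier R[i]; they are
   copied here, so that R[i] has the usual topology of the complex plane. *)
HB.instance Definition _ (R : realType) :=
  PseudoPointedMetric.copy R[i] R[i]^o.
HB.instance Definition _ (R : realType) := NormedModule.copy R[i] R[i]^o.

Section complex_sequences.
Context {R : realType}.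

(* e^{i x} *)
Definition expi (x : R) : R[i] := cos x +i* sin x.

(* Sequences are indexed from 1: the value of u at 0 is never used. *)
Definition average (u : nat -> R[i]) (N : nat) : R[i] :=
  N%:R^-1 * \sum_(1 <= n < N.+1) u n.

Definition oscillating (c : nat -> R[i]) : Prop :=
  forall t : R, 0 <= t < 1 ->
    average (fun n => c n * expi (- (2 * pi * n%:R * t))) @ \oo --> (0 : R[i]).

(* ComplexField.Normc.normc is the R-valued modulus, whereas `|z| lives in
   R[i]. *)
Definition growth_condition (c : nat -> R[i]) (lambda : R) : Prop :=
  (fun N : nat =>
     \sum_(1 <= n < N.+1) ComplexField.Normc.normc (c n) `^ lambda : R)
    =O_\oo (fun N : nat => N%:R : R).

End complex_sequences.

Section flows.
Context {R : realType} {X : metricType R}.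

Definition flow (T : X -> X) : Prop := compact [set: X] /\ continuous T.

(* A uniform condition for the metric; the library's equicontinuous is the
   pointwise notion for families of maps. *)
Definition equicontinuous_flow (T : X -> X) : Prop :=
  forall e : R, 0 < e -> exists2 d : R, 0 < d &
    forall x y : X, mdist x y < d ->
      forall n : nat, mdist (iter n T x) (iter n T y) < e.

Definition linearly_disjoint (c : nat -> R[i]) (T : X -> X) : Prop :=
  forall f : X -> R[i], continuous f -> forall x : X,
    average (fun n => c n * f (iter n T x)) @ \oo --> (0 : R[i]).

End flows.

(* Main.v *)
Require Import Defs.
From mathcomp Require Import all_boot all_order all_algebra.
From mathcomp Require Import all_classical all_reals all_analysis.
From mathcomp Require Import complex.
From mathcomp Require Import ring lra.

Import Order.TTheory GRing.Theory Num.Theory.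
Import numFieldTopology.Exports numFieldNormedType.Exports.

Local Open Scope ring_scope.

Set Implicit Arguments.
Unset Strict Implicit.
Unset Printing Implicit Defensive.

(** Along an orbit of an equicontinuous flow the sequence a n = f (T^n x) has
    shifts a (s + .) that form a totally bounded family for the sup norm:
    Bochner's form of almost periodicity, on one-sided sequences.  The heart of
    the proof is Bohr's theorem for such sequences ([bohr_approximation]):
    eventually, a is uniformly within any eps of a trigonometric polynomial.
    Given it, an oscillating c averages to 0 against every trigonometric
    polynomial, and the growth condition bounds the averages of |c n|, because
    |c n| <= 1 + |c n|^lambda; hence c averages to 0 against a.

    Bohr's theorem is proved by finite Fourier analysis on one long window.
    Split the shifts into r classes inside each of which they differ by at most
    eps, and let I, included in {0, ..., M-1}, be a class with at least M/r
    elements.  For p and q in I the values a (n + p - q) and a n are within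
    eps, so a n is within eps of the average of a (n + p - q) over all such p
    and q.  Fourier inversion modulo W = 2M writes this average as a combination
    of the windowed transforms
      B_t(s) = sum_(m < W) a (s + m) e(- m t),   t = xi/W,
    with coefficients of modulus |hat I (xi)|^2 / (W |I|^2), where hat I (xi)
    is the sum of e(p xi/W) over p in I.  By Parseval these coefficients add up
    to 1/|I|, which is at most r/M ([trig_close_differences]).

    It remains to approximate B_t by trigonometric polynomials with an error
    eta W, with the same W for all t.  For a single t a window mean of
    a n e(- n t) hardly depends on where the window starts, because that
    sequence also has totally bounded shifts; so B_t(s) is close to a constant
    times e(s t) ([trig_close_block]).  The estimate persists for nearby t and
    for multiples of W, and [0, 1] is compact
    ([trig_close_block_uniform]). *)

Local Notation normc := ComplexField.Normc.normc.
Local Arguments ComplexField.Normc.normc : simpl never.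

(** * The modulus of complex numbers *)

Section modulus.
Context {R : realType}.
Implicit Types (z w : R[i]) (x y : R).

Lemma normc_ge0 z : 0 <= normc z.
Proof. by case: z => a b; exact: sqrtr_ge0. Qed.

Lemma normcB z w : normc (z - w) = normc (w - z).
Proof. by rewrite -normcN opprB. Qed.

Lemma normc_sum (I : Type) (r : seq I) (P : pred I) (F : I -> R[i]) :
  normc (\sum_(i <- r | P i) F i) <= \sum_(i <- r | P i) normc (F i).
Proof.
elim/big_ind2: _ => [|z x w y hz hw|//].
  by rewrite ComplexField.Normc.normc0.
exact: le_trans (le_normcD _ _) (lerD hz hw).
Qed.

Lemma normc_norm z : `|z| = (normc z)%:C%C.
Proof. by case: z. Qed.

Lemma normc_nat n : normc (n%:R : R[i]) = n%:R.
Proof.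
have -> : (n%:R : R[i]) = (n%:R : R)%:C%C by rewrite rmorph_nat.
by rewrite /ComplexField.Normc.normc /= expr0n addr0 sqrtr_sqr ger0_norm.
Qed.

Lemma normc_le_ReIm z : normc z <= `|complex.Re z| + `|complex.Im z|.
Proof.
case: z => a b; rewrite /ComplexField.Normc.normc /=.
rewrite -(ger0_norm (addr_ge0 (normr_ge0 a) (normr_ge0 b))).
rewrite -sqrtr_sqr ler_wsqrtr //.
rewrite sqrrD !real_normK ?num_real // lerD2r lerDl.
by rewrite mulrn_wge0 // mulr_ge0.
Qed.

End modulus.

(** * The characters of the reals *)

Section phase.
Local Open Scope classical_set_scope.
Local Open Scope ring_scope.
Context {R : realType}.
Implicit Types x y t : R.

Definition phase x : R[i] := expi (2 * pi * x).

Lemma phase0 : phase 0 = 1.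
Proof. by rewrite /phase /expi mulr0 cos0 sin0. Qed.

Lemma phaseD x y : phase (x + y) = phase x * phase y.
Proof.
rewrite /phase mulrDr /expi cosD sinD.
by apply/eqP; rewrite eq_complex /=; apply/andP; split; apply/eqP; ring.
Qed.

Lemma normc_phase x : normc (phase x) = 1.
Proof. by rewrite /ComplexField.Normc.normc /phase /expi cos2Dsin2 sqrtr1. Qed.

Lemma phaseN x : phase (- x) = (phase x)^*%C.
Proof. by rewrite /phase /expi mulrN cosN sinN. Qed.

Lemma phase_prod x n : phase (n%:R * x) = phase x ^+ n.
Proof.
elim: n => [|n IH]; first by rewrite mul0r phase0.
by rewrite -natr1 mulrDl mul1r phaseD IH exprSr.
Qed.

Lemma phase1 : phase 1 = 1.
Proof. by rewrite /phase /expi mulr1 mulrC mulr_natr cos2pi sin2pi. Qed.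

Lemma phaseNr x : phase x * phase (- x) = 1.
Proof. by rewrite -phaseD subrr phase0. Qed.

Lemma phase_nat n : phase n%:R = 1.
Proof. by rewrite -[n%:R]mulr1 phase_prod phase1 expr1n. Qed.

Lemma phase_int (m : int) : phase m%:~R = 1.
Proof.
case: m => n; first by rewrite -pmulrn phase_nat.
by rewrite NegzE mulrNz -pmulrn -[LHS]mul1r -{1}(phase_nat n.+1) phaseNr.
Qed.

(** The real part of [phase x] is 1 - 2 sin^2 (pi x), and the sine does not
    vanish strictly between 0 and pi. *)
Lemma phase_neq1 x : 0 < `|x| < 1 -> phase x != 1.
Proof.
case/andP=> x0 x1; rewrite /phase /expi eq_complex /= negb_and; apply/orP; left.
have -> : 2 * pi * x = (pi * x) *+ 2 by rewrite -mulrA mulr_natl.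
rewrite cos_mulr2n lt_eqF // cos2sin2 mulrnBl.
have s0 : 0 < sin (pi * x) ^+ 2.
  rewrite exprn_even_gt0 //=.
  (* sin^2 is even *)
  wlog xp : x x0 x1 / 0 <= x => [H|].
    case: (leP 0 x) => [/H->//|xn]; have := H (- x).
    by rewrite normrN mulrN sinN oppr_eq0; apply=> //; lra.
  rewrite ger0_norm // in x0 x1.
  by rewrite gt_eqF // sin_gt0_pi // mulr_gt0 ?pi_gt0 //= gtr_pMr ?pi_gt0.
by lra.
Qed.

Lemma phase_frac x : phase (x - (Num.floor x)%:~R) = phase x.
Proof.
by rewrite phaseD -mulrNz phase_int mulr1.
Qed.

Lemma phase_near1 (eps : R) : 0 < eps ->
  exists2 d : R, 0 < d & forall x, `|x| < d -> normc (phase x - 1) <= eps.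
Proof.
move=> e0.
have l0 : (2 * pi * x) @[x --> (0 : R)] --> (0 : R).
  by rewrite -[X in _ --> X](mulr0 (2 * pi : R)); exact: mulrl_continuous.
have c1 : cos (2 * pi * x) @[x --> (0 : R)] --> (1 : R).
  rewrite -[X in _ --> X](@cos0 R); exact: (cvg_comp _ _ l0 (@continuous_cos R 0)).
have s1 : sin (2 * pi * x) @[x --> (0 : R)] --> (0 : R).
  rewrite -[X in _ --> X](@sin0 R); exact: (cvg_comp _ _ l0 (@continuous_sin R 0)).
have e2 : 0 < eps / 2 by lra.
move/cvgrPdist_le/(_ _ e2) : c1 => c1; move/cvgrPdist_le/(_ _ e2) : s1 => s1.
have /nbhs_norm0P[d /= d0 H] : \forall x \near (0 : R),
    `|1 - cos (2 * pi * x)| <= eps / 2 /\ `|0 - sin (2 * pi * x)| <= eps / 2.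
  exact: filterI c1 s1.
exists d => // x /H[/=].
move=> h1 h2; apply: (le_trans (normc_le_ReIm _)) => /=.
by move: h1 h2; rewrite sub0r normrN distrC subr0; lra.
Qed.

Lemma normc_phaseB x y : normc (phase x - phase y) = normc (phase (x - y) - 1).
Proof.
have -> : phase x - phase y = (phase (x - y) - 1) * phase y.
  by rewrite mulrBl mul1r -phaseD subrK.
by rewrite ComplexField.Normc.normcM normc_phase mulr1.
Qed.

(** Orthogonality of the characters of Z/W, as a geometric sum whose ratio is a
    W-th root of unity; [j] and [k] are below [W], so the ratio is 1 only when
    they are equal. *)
Lemma sum_phase_root (W j k : nat) : (j < W)%N -> (k < W)%N ->
  \sum_(xi < W) phase (xi%:R * ((j%:R - k%:R) / W%:R)) =
    if j == k then W%:R else 0.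
Proof.
move=> jW kW; have W0 : 0 < (W%:R : R) by rewrite ltr0n (leq_trans _ jW).
under eq_bigr do rewrite phase_prod.
set z := phase _.
case: eqVneq => [jk|jk].
  rewrite /z jk subrr mul0r phase0.
  by under eq_bigr do rewrite expr1n; rewrite sumr_const card_ord.
have z1 : z != 1.
  have d0 : (j%:R - k%:R : R) != 0 by rewrite subr_eq0 eqr_nat.
  apply: phase_neq1; rewrite normr_gt0 mulf_neq0 ?invr_eq0 ?(gt_eqF W0) //=.
  rewrite normrM normfV (gtr0_norm W0) ltr_pdivrMr // mul1r.
  have : 0 <= (j%:R : R) by []. have : 0 <= (k%:R : R) by [].
  have : (j%:R : R) < W%:R by rewrite ltr_nat.
  have : (k%:R : R) < W%:R by rewrite ltr_nat.
  by rewrite ltr_norml; lra.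
have : (z - 1) * (\sum_(i < W) z ^+ i) = 0.
  rewrite -subrX1 -phase_prod mulrC divfK ?gt_eqF //.
  by rewrite phaseD phase_nat mul1r -[phase _]mul1r -{1}(phase_nat k) phaseNr subrr.
by move/eqP; rewrite mulf_eq0 subr_eq0 (negPf z1) /= => /eqP.
Qed.

End phase.

(** * Approximation by trigonometric polynomials *)

Section trig_close.
Context {R : realType}.
Local Open Scope classical_set_scope.
Local Open Scope ring_scope.
Implicit Types (u v : nat -> R[i]) (eps t : R) (l : seq (R[i] * R)).

(** The pairs are (coefficient, frequency). *)
Definition trig l (n : nat) : R[i] := \sum_(z <- l) z.1 * phase (n%:R * z.2).

(** The approximation is required only eventually, because for a map that is
    not invertible the beginning of an orbit need not look almost periodic. *)
Definition trig_close eps u : Prop :=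
  exists l, \forall n \near \oo, normc (u n - trig l n) <= eps.

Lemma trig_close_perturb eps d u v : trig_close eps u ->
  (\forall n \near \oo, normc (v n - u n) <= d) -> trig_close (eps + d) v.
Proof.
move=> [l ul] vu; exists l; near=> n.
have -> : v n - trig l n = (u n - trig l n) + (v n - u n).
  by ring.
by apply: le_trans (le_normcD _ _) _; apply: lerD; near: n.
Unshelve. all: by end_near. Qed.

Lemma trig_close_le eps eps' u : eps <= eps' -> trig_close eps u ->
  trig_close eps' u.
Proof.
by move=> le [l ul]; exists l; apply: filterS ul => n /le_trans; apply.
Qed.

Lemma trig_close0 : trig_close 0 (fun=> 0).
Proof.
by exists [::]; near=> n; rewrite /trig big_nil subr0 ComplexField.Normc.normc0.
Unshelve. all: by end_near. Qed.

Lemma trig_closeD eps eps' u v : trig_close eps u -> trig_close eps' v ->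
  trig_close (eps + eps') (fun n => u n + v n).
Proof.
move=> [l ul] [k vk]; exists (l ++ k); near=> n.
rewrite /trig big_cat /= opprD addrACA.
by apply: le_trans (le_normcD _ _) _; apply: lerD; near: n.
Unshelve. all: by end_near. Qed.

Lemma trig_close_sum (I : Type) (r : seq I) (eps : I -> R) (u : I -> nat -> R[i]) :
  (forall i, trig_close (eps i) (u i)) ->
  trig_close (\sum_(i <- r) eps i) (fun n => \sum_(i <- r) u i n).
Proof.
move=> H; elim: r => [|i r IH].
  have -> : (fun n => \sum_(i <- [::]) u i n) = fun=> 0.
    by apply/funext => n; rewrite big_nil.
  by rewrite big_nil; exact: trig_close0.
have -> : (fun n => \sum_(j <- i :: r) u j n) =
    fun n => u i n + \sum_(j <- r) u j n.
  by apply/funext => n; rewrite big_cons.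
by rewrite big_cons; exact: trig_closeD.
Qed.

Lemma trig_closeZ (z : R[i]) eps u : trig_close eps u ->
  trig_close (normc z * eps) (fun n => z * u n).
Proof.
move=> [l ul]; exists [seq (z * w.1, w.2) | w <- l]; near=> n.
have -> : trig [seq (z * w.1, w.2) | w <- l] n = z * trig l n.
  by rewrite /trig big_map mulr_sumr; apply: eq_bigr => w _; rewrite mulrA.
rewrite -mulrBr ComplexField.Normc.normcM ler_wpM2l ?normc_ge0 //; near: n.
exact: ul.
Unshelve. all: by end_near. Qed.

Lemma trig_shift l t n :
  trig [seq (w.1 * phase (t * w.2), w.2) | w <- l] n =
  \sum_(z <- l) z.1 * phase ((n%:R + t) * z.2).
Proof.
by rewrite /trig big_map; apply: eq_bigr => w _ /=; rewrite mulrDl phaseD; ring.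
Qed.

Lemma trig_close_shift s eps u : trig_close eps u ->
  trig_close eps (fun n => u (n + s)%N).
Proof.
move=> [l ul]; exists [seq (w.1 * phase (s%:R * w.2), w.2) | w <- l].
have us : \forall n \near \oo, normc (u (n + s)%N - trig l (n + s)%N) <= eps.
  exact: (cvg_addnr s) ul.
by apply: filterS us => n; rewrite trig_shift -natrD.
Qed.

(** Delaying a trigonometric polynomial multiplies its coefficients by phases,
    and the finitely many terms lost by the delay do not count. *)
Lemma trig_close_unshift s eps u : trig_close eps (fun n => u (n + s)%N) ->
  trig_close eps u.
Proof.
move=> [l [N _ ul]]; exists [seq (w.1 * phase (- s%:R * w.2), w.2) | w <- l].
exists (N + s)%N => // n /= Nn.
have sn : (s <= n)%N by rewrite (leq_trans _ Nn) // leq_addl.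
rewrite trig_shift -natrB //; have := ul (n - s)%N; rewrite subnK //; apply.
by rewrite /= leq_subRL // addnC.
Qed.

End trig_close.

(** * Sequences with totally bounded shifts *)

Section precompact_shifts.
Context {R : realType}.
Implicit Types (a b : nat -> R[i]) (eps t : R).

(** Total boundedness of the shifts of [a] for the sup norm, phrased as a finite
    colouring of the shifts with classes of small diameter; this form passes
    to products by pairing colours and lends itself to the pigeonhole
    principle. *)
Definition precompact_shifts a : Prop := forall eps : R, 0 < eps ->
  exists (F : finType) (phi : nat -> F), forall s s', phi s = phi s' ->
    forall m, normc (a (s + m)%N - a (s' + m)%N) <= eps.

Lemma early_values (F : finType) (phi : nat -> F) :
  exists K, forall s, exists2 k, (k < K)%N & phi k = phi s.
Proof.
have ex f : exists k, forall s, phi s = f -> phi k = f.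
  have [[k kf]|nk] := pselect (exists k, phi k = f); first by exists k.
  by exists 0%N => s sf; case: nk; exists s.
have [k kP] := choice ex; exists (\max_(f : F) k f).+1 => s.
by exists (k (phi s)); [rewrite ltnS; exact: leq_bigmax|exact: kP].
Qed.

Lemma precompact_bounded a : precompact_shifts a ->
  exists2 B : R, 0 < B & forall n, normc (a n) <= B.
Proof.
move=> /(_ _ ltr01)[F [phi aphi]]; have [K Kphi] := early_values phi.
have S0 : 0 <= \sum_(k < K) normc (a k).
  by apply: sumr_ge0 => k _; exact: normc_ge0.
exists (\sum_(k < K) normc (a k) + 1) => [|n]; first exact: ltr_wpDl.
have [k kK /aphi/(_ 0%N)] := Kphi n; rewrite !addn0 normcB => ank.
rewrite -(subrK (a k) (a n)) addrC; apply: le_trans (le_normcD _ _) _.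
apply: lerD => //; rewrite (bigD1 (Ordinal kK)) //= lerDl.
by apply: sumr_ge0 => j _; exact: normc_ge0.
Qed.

(** The colour of a shift is the box of length 1/q that contains the fractional
    part of [s * t]. *)
Lemma precompact_phase t : precompact_shifts (fun n => phase (n%:R * t)).
Proof.
move=> eps /phase_near1[d d0 near1].
pose frac (x : R) := x - (Num.floor x)%:~R.
have frac_itv x : 0 <= frac x < 1.
  by have := floor_itv x; rewrite intrD1 /frac; lra.
pose q := (Num.truncn d^-1).+1.
have q0 : 0 < q%:R :> R by rewrite ltr0n.
have qd : q%:R^-1 < d by rewrite -[d]invrK ltf_pV2 ?posrE ?invr_gt0 // truncnS_gt.
(* [inord] needs a successor; the box of index q stays empty. *)
pose box (x : R) : 'I_q.+1 := inord (Num.truncn (q%:R * frac x)).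
have boxE x : (box x : nat)%:R <= q%:R * frac x < (box x).+1%:R.
  have /andP[f0 f1] := frac_itv x.
  have qf : 0 <= q%:R * frac x by rewrite mulr_ge0 // ltW.
  rewrite /box inordK; first exact: truncn_itv.
  rewrite ltnS truncn_le_nat (lt_trans (_ : _ < q%:R)) ?ltr_nat //.
  by rewrite -[ltRHS]mulr1 ltr_pM2l.
exists 'I_q.+1, (fun s => box (s%:R * t)) => s s' ss' m.
rewrite !natrD !mulrDl !phaseD -mulrBl ComplexField.Normc.normcM normc_phase mulr1.
rewrite -(phase_frac (s%:R * t)) -(phase_frac (s'%:R * t)) normc_phaseB.
apply: near1; apply: lt_trans qd.
rewrite -/(frac _) -/(frac _).
have := boxE (s%:R * t); have := boxE (s'%:R * t); rewrite ss' -natr1.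
set x := frac _; set y := frac _; set c := (_%:R : R).
move=> /andP[c1 c2] /andP[c3 c4].
rewrite -(ltr_pM2l q0) divff ?gt_eqF // -{1}(gtr0_norm q0) -normrM.
rewrite mulrBr ltr_norml.
lra.
Qed.

Lemma precompactM a b : precompact_shifts a -> precompact_shifts b ->
  precompact_shifts (fun n => a n * b n).
Proof.
move=> pa pb eps e0.
have [A A0 aA] := precompact_bounded pa; have [B B0 bB] := precompact_bounded pb.
have [|F [phi aphi]] := pa (eps / 2 / B); first by rewrite !divr_gt0.
have [|G [psi bpsi]] := pb (eps / 2 / A); first by rewrite !divr_gt0.
exists (F * G)%type, (fun s => (phi s, psi s)) => s s' [ss1 ss2] m.
set x := (s + m)%N; set y := (s' + m)%N.
have -> : a x * b x - a y * b y = (a x - a y) * b x + a y * (b x - b y) by ring.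
apply: le_trans (le_normcD _ _) _.
rewrite !ComplexField.Normc.normcM (splitr eps) lerD //.
  rewrite -[leRHS](divfK (lt0r_neq0 B0)) ler_pM ?normc_ge0 //; exact: aphi.
rewrite mulrC -[leRHS](divfK (lt0r_neq0 A0)) ler_pM ?normc_ge0 //; exact: bpsi.
Qed.

(** Sums over long windows barely depend on the start of the window: up to eta/2
    per term the start may be replaced by one of finitely many early starts,
    and moving a window by less than [K] changes its sum by at most 2BK,
    whatever its length. *)
Lemma precompact_mean b eta : precompact_shifts b -> 0 < eta ->
  exists2 M, (0 < M)%N & forall s,
    normc (\sum_(0 <= m < M) b (s + m)%N - \sum_(0 <= m < M) b m) <= eta * M%:R.
Proof.
move=> pb e0; have [B B0 bB] := precompact_bounded pb.
have e2 : 0 < eta / 2 by lra.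
have [F [phi bphi]] := pb _ e2; have [K Kphi] := early_values phi.
have early_start M k :
    normc (\sum_(0 <= m < M) b (k + m)%N - \sum_(0 <= m < M) b m)
    <= 2 * B * k%:R.
  elim: k => [|k IH].
    by under eq_bigr do rewrite add0n; rewrite subrr ComplexField.Normc.normc0 mulr0.
  have -> : \sum_(0 <= m < M) b (k.+1 + m)%N =
     \sum_(0 <= m < M) b (k + m)%N + (b (k + M)%N - b k).
    apply: (addIr (b k)); rewrite addrA subrK.
    under eq_bigr do rewrite addSnnS.
    rewrite -(big_nat_recr M 0%N (fun m => b (k + m)%N)) //= big_nat_recl //.
    by rewrite addn0 addrC.
  rewrite addrAC; apply: le_trans (le_normcD _ _) _.
  rewrite -(natr1 k) mulrDr mulr1 lerD //.
  apply: le_trans (le_normcD _ _) _; rewrite normcN mulr2n mulrDl mul1r lerD //.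
pose M := (Num.truncn (2 * B * K%:R / (eta / 2))).+1.
exists M => // s; have [k kK ks] := Kphi s.
rewrite -(subrK (\sum_(0 <= m < M) b (k + m)%N) (\sum_(0 <= m < M) b (s + m)%N)).
rewrite -addrA; apply: le_trans (le_normcD _ _) _.
rewrite (splitr eta) mulrDl lerD //.
  rewrite -sumrB; apply: le_trans (normc_sum _ _ _) _.
  apply: (@le_trans _ _ (\sum_(0 <= m < M) (eta / 2))).
    by apply: ler_sum => m _; exact: bphi.
  by rewrite sumr_const_nat subn0 mulr_natr.
apply: le_trans (early_start _ _) _.
apply: (@le_trans _ _ (2 * B * K%:R)).
  by rewrite ler_wpM2l ?ler_nat 1?ltnW // mulr_ge0 // ltW.
by rewrite -ler_pdivrMl // [X in X <= _]mulrC ltW // truncnS_gt.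
Qed.

End precompact_shifts.

(** * Finite subcovers *)

(** A covering by neighbourhoods, not necessarily open, indexed by the points
    themselves; it is the covering form of compactness for the filter of large
    finite lists. *)
Lemma compact_finite_cover (T : topologicalType) (K : set T) (U : T -> set T) :
  compact K -> (forall x, K x -> nbhs x (U x)) ->
  exists l : seq T, forall x, K x -> exists2 y, y \in l & U y x.
Proof.
move=> /compact_near_coveringP cK UK.
pose F : set_system (seq T) :=
  [set A : set (seq T) | exists l : seq T, forall l', {subset l <= l'} -> A l']%classic.
have FF : Filter F.
  split; first by exists [::].
    move=> A B [l Al] [k Bk]; exists (l ++ k) => m lkm; split.
      by apply: Al => x xl; apply: lkm; rewrite mem_cat xl.
    by apply: Bk => x xk; apply: lkm; rewrite mem_cat xk orbT.
  by move=> A B AB [l Al]; exists l => m /Al /AB.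
have [|l] := cK _ F (fun l x => exists2 y, y \in l & U y x) FF.
  move=> x Kx; exists (U x, [set l : seq T | x \in l])%classic => /=.
    split; first exact: UK.
    by exists [:: x] => l; apply; rewrite inE.
  by move=> [y l] [/= Uxy xl]; exists x.
by move=> /(_ l (fun _ => id)) lK; exists l.
Qed.

(** * Windowed Fourier transforms *)

Section blocks.
Context {R : realType}.
Implicit Types (a : nat -> R[i]) (eta t : R) (M s : nat).

Definition block a t M s : R[i] :=
  \sum_(0 <= m < M) a (s + m)%N * phase (- (m%:R * t)).

(** The window sums of a n e(- n t) are nearly constant, and [block] at [s] is
    such a sum times e(s t). *)
Lemma trig_close_block a t eta : precompact_shifts a -> 0 < eta ->
  exists2 M, (0 < M)%N & trig_close (eta * M%:R) (block a t M).
Proof.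
move=> pa e0.
have [M M0 bM] := precompact_mean (precompactM pa (precompact_phase (- t))) e0.
exists M => //.
exists [:: (\sum_(0 <= m < M) a m * phase (m%:R * - t), t)]; near=> s.
rewrite /trig big_seq1 /= mulrC.
have -> : block a t M s = phase (s%:R * t) *
    \sum_(0 <= m < M) a (s + m)%N * phase ((s + m)%:R * - t).
  rewrite mulr_sumr; apply: eq_bigr => m _.
  rewrite mulrCA -phaseD; congr (_ * phase _); rewrite natrD; ring.
rewrite -mulrBr ComplexField.Normc.normcM normc_phase mul1r; exact: bM.
Unshelve. all: by end_near. Qed.

Lemma blockD a t M N s :
  block a t (M + N) s =
    block a t M s + phase (- (M%:R * t)) * block a t N (s + M)%N.
Proof.
rewrite /block (@big_cat_nat _ _ _ M) ?leq_addr //=; congr (_ + _).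
rewrite -[X in \sum_(X <= i < _) _]add0n big_addn addKn mulr_sumr.
apply: eq_bigr => m _.
rewrite mulrCA -phaseD (addnC m) addnA; congr (_ * phase _).
rewrite natrD; ring.
Qed.

(** A window of length [q * M] is cut into [q] windows of length [M]; each
    contributes a shift of [block a t M] multiplied by a phase. *)
Lemma trig_close_blockM a t eta M q : trig_close (eta * M%:R) (block a t M) ->
  trig_close (eta * (q * M)%:R) (block a t (q * M)).
Proof.
move=> cl; elim: q => [|q IH].
  rewrite mul0n mulr0; have -> : block a t 0 = fun=> 0; last exact: trig_close0.
  by apply/funext => s; rewrite /block big_geq.
have -> : block a t (q.+1 * M) = fun s => block a t (q * M) s +
    phase (- ((q * M)%:R * t)) * block a t M (s + q * M)%N.
  by apply/funext => s; rewrite mulSnr blockD.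
rewrite mulSnr natrD mulrDr; apply: trig_closeD => //.
have := trig_closeZ (phase (- ((q * M)%:R * t))) (trig_close_shift (q * M) cl).
by rewrite normc_phase mul1r.
Qed.

Lemma block_near a t eta M : precompact_shifts a -> 0 < eta ->
  (\forall t' \near t, forall s,
    normc (block a t' M s - block a t M s) <= eta * M%:R)%classic.
Proof.
move=> pa e0; have [B B0 aB] := precompact_bounded pa.
have [|d d0 dP] := @phase_near1 R (eta / B); first by rewrite divr_gt0.
have dM : 0 < d / M.+1%:R by rewrite divr_gt0.
apply/nbhs_ballP; exists (d / M.+1%:R) => //= t' tt' s.
rewrite -sumrB; apply: le_trans (normc_sum _ _ _) _.
apply: (@le_trans _ _ (\sum_(0 <= m < M) eta)); last first.
  by rewrite sumr_const_nat subn0 mulr_natr.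
apply: ler_sum_nat => m /andP[_ mM].
rewrite -mulrBr ComplexField.Normc.normcM normc_phaseB.
rewrite -(divfK (lt0r_neq0 B0) eta) mulrC ler_pM ?normc_ge0 //.
apply: dP; have -> : - (m%:R * t') - - (m%:R * t) = m%:R * (t - t') by ring.
rewrite normrM ger0_norm //.
apply: (@le_lt_trans _ _ (M.+1%:R * `|t - t'|)).
  by rewrite ler_wpM2r // ler_nat (leq_trans (ltnW mM)).
by rewrite mulrC -ltr_pdivlMr.
Qed.

(** The window length that works at [t] works in a neighbourhood of [t]; the
    product of finitely many of these lengths is a multiple of each of them. *)
Lemma trig_close_block_uniform a eta : precompact_shifts a -> 0 < eta ->
  exists2 M, (0 < M)%N &
    forall t, 0 <= t <= 1 -> trig_close (eta * M%:R) (block a t M).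
Proof.
move=> pa e0; have e2 : 0 < eta / 2 by lra.
have ex t : exists M, (0 < M)%N /\ trig_close (eta / 2 * M%:R) (block a t M).
  by have [M M0 cl] := trig_close_block t pa e2; exists M.
have [M MP] := choice ex.
have [|l lP] := @compact_finite_cover R `[0, 1]%classic
    (fun t => [set t' | forall s, normc (block a t' (M t) s - block a t (M t) s)
      <= eta / 2 * (M t)%:R]%classic) (@segment_compact R 0 1).
  by move=> t _; apply: block_near.
exists (\prod_(t <- l) M t)%N => [|t t01].
  by rewrite prodn_gt0 // => t; case: (MP t).
have [|y yl yt] := lP t; first by rewrite /= in_itv.
have cl : trig_close (eta * (M y)%:R) (block a t (M y)).
  rewrite (splitr eta) mulrDl; apply: (trig_close_perturb (MP y).2).
  exact: nearW.
by rewrite (big_rem y yl) /= mulnC; exact: trig_close_blockM.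
Qed.

(** Fourier inversion on Z/W for the window of [a] that starts at [s]. *)
Lemma block_inversion a W k s : (k < W)%N ->
  a (s + k)%N = W%:R^-1 *
    \sum_(xi < W) phase (xi%:R * (k%:R / W%:R)) * block a (xi%:R / W%:R) W s.
Proof.
move=> kW; pose F (xi j : 'I_W) :=
  a (s + j)%N * phase (xi%:R * ((k%:R - j%:R) / W%:R)).
rewrite (eq_bigr (fun xi => \sum_(j < W) F xi j)) => [|xi _]; last first.
  rewrite /block big_mkord mulr_sumr; apply: eq_bigr => j _.
  by rewrite mulrCA -phaseD /F; congr (_ * phase _); ring.
rewrite exchange_big /= (bigD1 (Ordinal kW)) //= [X in _ + X]big1 => [|j jk].
  rewrite -mulr_sumr sum_phase_root // eqxx addr0 mulrC mulfK //.
  by rewrite pnatr_eq0 -lt0n (leq_ltn_trans _ kW).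
rewrite -mulr_sumr sum_phase_root // ifN ?mulr0 //.
by apply: contraNN jk => /eqP jk; apply/eqP/val_inj.
Qed.

(** The Fourier transform of the indicator function of [I]. *)
Definition char_sum M (I : {set 'I_M}) (x : R) : R[i] :=
  \sum_(p in I) phase (p%:R * x).

Lemma char_sum_sqr M (I : {set 'I_M}) (x : R) :
  (normc (char_sum I x) ^+ 2)%:C%C =
  \sum_(p in I) \sum_(q in I) phase ((p%:R - q%:R) * x).
Proof.
rewrite rmorphXn /= -normc_norm sqr_normc.
rewrite [X in _ * X](rmorph_sum (@conjc R)) /= mulr_suml; apply: eq_bigr => p _.
rewrite mulr_sumr; apply: eq_bigr => q _.
by rewrite -[X in _ * X]/(phase (q%:R * x))^*%C -phaseN -phaseD -mulrBl.
Qed.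

Lemma parseval M W (I : {set 'I_M}) : (M <= W)%N ->
  \sum_(xi < W) normc (char_sum I (xi%:R / W%:R)) ^+ 2 = (W * #|I|)%:R.
Proof.
move=> MW; apply: (fmorph_inj (real_complex R)); rewrite rmorph_sum rmorph_nat.
rewrite (eq_bigr _ (fun (xi : 'I_W) _ => char_sum_sqr I (xi%:R / W%:R))).
rewrite exchange_big /= natrM -sum1_card natr_sum mulr_sumr.
apply: eq_bigr => p pI.
rewrite exchange_big /= (bigD1 p) //= [X in _ + X]big1 => [|q].
  rewrite addr0 mulr1; under eq_bigr do rewrite subrr mul0r phase0.
  by rewrite sumr_const card_ord.
case/andP=> _ qp; under eq_bigr do rewrite mulrCA.
rewrite sum_phase_root ?(leq_trans (ltn_ord _)) // ifN //.
by apply: contraNN qp => /eqP pq; apply/eqP/val_inj.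
Qed.

(** The offset [M] keeps the indices M + p - q in a window of length M + M.
    The set enters twice with opposite signs, which produces the square of the
    modulus of [char_sum]. *)
Lemma sum_differences a M (I : {set 'I_M}) s :
  \sum_(p in I) \sum_(q in I) a (s + (M + p - q))%N =
  \sum_(xi < M + M) ((M + M)%:R^-1 * phase (xi%:R * (M%:R / (M + M)%:R)) *
    (normc (char_sum I (xi%:R / (M + M)%:R)) ^+ 2)%:C%C) *
      block a (xi%:R / (M + M)%:R) (M + M) s.
Proof.
set W := (M + M)%N.
have ind (p q : 'I_M) : (M + p - q < W)%N.
  by rewrite (leq_ltn_trans (leq_subr _ _)) // ltn_add2l.
under eq_bigr => p _ do
  under eq_bigr => q _ do rewrite (block_inversion a s (ind p q)).
under eq_bigr do rewrite -mulr_sumr exchange_big /=.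
rewrite -mulr_sumr exchange_big /= mulr_sumr; apply: eq_bigr => xi _.
rewrite -!mulrA; congr (_ * _); rewrite char_sum_sqr mulr_suml mulr_sumr.
apply: eq_bigr => p _; rewrite mulr_suml mulr_sumr.
apply: eq_bigr => q _; rewrite [RHS]mulrA; congr (_ * _).
rewrite -phaseD; congr phase; rewrite natrB ?natrD; first by ring.
by rewrite (leq_trans (ltnW (ltn_ord q))) // leq_addr.
Qed.

(** The weights of the windowed transforms are nonnegative up to phases, so by
    Parseval the errors add up to #|I| times the error on one of them. *)
Lemma trig_close_differences a M (I : {set 'I_M}) eta :
  (forall t, 0 <= t <= 1 -> trig_close (eta * (M + M)%:R) (block a t (M + M))) ->
  trig_close (eta * (M + M)%:R * #|I|%:R)
    (fun s => \sum_(p in I) \sum_(q in I) a (s + (M + p - q))%N).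
Proof.
set W := (M + M)%N => cl.
have -> : (fun s => \sum_(p in I) \sum_(q in I) a (s + (M + p - q))%N) =
    fun s => \sum_(xi < W) (W%:R^-1 * phase (xi%:R * (M%:R / W%:R)) *
    (normc (char_sum I (xi%:R / W%:R)) ^+ 2)%:C%C) * block a (xi%:R / W%:R) W s.
  by apply/funext => s; exact: sum_differences.
have [W0|W0] := posnP W.
  exists [::]; near=> n; rewrite /trig big_nil subr0 W0 big_ord0 mulr0 mul0r.
  by rewrite ComplexField.Normc.normc0.
have -> : eta * W%:R * #|I|%:R = \sum_(xi < W)
    W%:R^-1 * normc (char_sum I (xi%:R / W%:R)) ^+ 2 * (eta * W%:R).
  rewrite -mulr_suml -mulr_sumr parseval ?leq_addr //.
  rewrite natrM mulKf ?pnatr_eq0 ?gtn_eqF //.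
  by rewrite mulrC.
apply: trig_close_sum => xi.
set z : R[i] := (_ * phase _ * _).
have -> : W%:R^-1 * normc (char_sum I (xi%:R / W%:R)) ^+ 2 = normc z.
  rewrite /z !ComplexField.Normc.normcM ComplexField.Normc.normcV normc_nat.
  rewrite normc_phase mulr1; congr (_ * _).
  rewrite /ComplexField.Normc.normc /= expr0n addr0 sqrtr_sqr ger0_norm // exprn_ge0 //.
  exact: normc_ge0.
apply: trig_closeZ; apply: cl.
rewrite divr_ge0 //= ler_pdivrMr ?ltr0n // mul1r ler_nat ltnW //.
Unshelve. all: by end_near. Qed.

(** Pigeonhole: otherwise the #|F| classes would be too small to fill [M]. *)
Lemma large_colour (F : finType) (phi : nat -> F) M :
  exists f, (M <= #|F| * #|[set p : 'I_M | phi p == f]|)%N.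
Proof.
apply/existsP; apply: contraT; rewrite negb_exists => /forallP small.
have M_sum : M = (\sum_(f : F) #|[set p : 'I_M | phi p == f]|)%N.
  rewrite -[LHS]card_ord -sum1_card (partition_big (fun p : 'I_M => phi p) predT) //.
  by apply: eq_bigr => f _; rewrite -sum1_card; apply: eq_bigl => p; rewrite inE.
have F0 : (0 < #|F|)%N by apply/card_gt0P; exists (phi 0%N).
have M0 : (0 < M)%N by have := small (phi 0%N); rewrite -ltnNge; exact: leq_trans.
suff : (#|F| * M < #|F| * M)%N by rewrite ltnn.
rewrite {1}M_sum big_distrr /= (@leq_ltn_trans (\sum_(f : F) M.-1)) //.
  by apply: leq_sum => f _; rewrite -ltnS prednK // ltnNge small.
by rewrite sum_nat_const ltn_pmul2l // prednK.
Qed.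

(** Bohr's theorem.  Half of [eps] pays for replacing [a] by its average over
    the differences of a colour class [I], the other half for approximating this
    average, with an error eta W / #|I| where W = 2 M and M <= #|F| #|I|; hence
    eta = eps / (4 #|F|). *)
Lemma bohr_approximation a eps : precompact_shifts a -> 0 < eps ->
  trig_close eps a.
Proof.
move=> pa e0; have e2 : 0 < eps / 2 by lra.
have [F [phi aphi]] := pa _ e2.
have F0 : (0 < #|F|)%N by apply/card_gt0P; exists (phi 0%N).
have Fr : 0 < (#|F|%:R : R) by rewrite ltr0n.
have h0 : 0 < eps / 2 / 2 / #|F|%:R by rewrite !divr_gt0.
have [M M0 cl1] := trig_close_block_uniform pa h0.
have cl t : 0 <= t <= 1 ->
    trig_close (eps / 2 / 2 / #|F|%:R * (M + M)%:R) (block a t (M + M)).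
  by move=> /cl1/(@trig_close_blockM _ _ _ _ 2); rewrite mul2n -addnn.
have [f fM] := large_colour phi M.
set I := [set p : 'I_M | phi p == f] in fM.
have I0 : (0 < #|I|)%N by move: (leq_trans M0 fM); rewrite muln_gt0 => /andP[].
have Ir : 0 < (#|I|%:R : R) by rewrite ltr0n.
apply: (@trig_close_unshift _ M); rewrite (splitr eps).
pose z : R[i] := (#|I| * #|I|)%:R^-1.
have nz : normc z = (#|I|%:R * #|I|%:R)^-1.
  by rewrite /z ComplexField.Normc.normcV normc_nat natrM.
have := trig_closeZ z (trig_close_differences I cl).
have le : normc z * (eps / 2 / 2 / #|F|%:R * (M + M)%:R * #|I|%:R) <= eps / 2.
  have Mr : M%:R <= #|F|%:R * #|I|%:R :> R by rewrite -natrM ler_nat.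
  have -> : normc z * (eps / 2 / 2 / #|F|%:R * (M + M)%:R * #|I|%:R) =
      eps / 2 * (M%:R / (#|F|%:R * #|I|%:R)).
    by rewrite nz natrD; field; rewrite ?gt_eqF.
  by rewrite ger_pMr // ler_pdivrMr ?mulr_gt0 // mul1r.
move=> /(trig_close_le le)/trig_close_perturb; apply; apply: nearW => s.
have -> : a (s + M)%N = z * \sum_(p in I) \sum_(q in I) a (s + M)%N.
  rewrite !sumr_const -mulrnA -mulr_natl mulrA mulVf ?mul1r //.
  by rewrite pnatr_eq0 muln_eq0 negb_or -!lt0n I0.
rewrite -mulrBr ComplexField.Normc.normcM nz -sumrB.
rewrite -ler_pdivlMl ?invr_gt0 ?mulr_gt0 // invrK.
apply: le_trans (normc_sum _ _ _) _.
rewrite -mulrA [leRHS]mulr_natl -sumr_const; apply: ler_sum => p pI.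
rewrite -sumrB; apply: le_trans (normc_sum _ _ _) _.
rewrite [leRHS]mulr_natl -sumr_const; apply: ler_sum => q qI.
have qM := ltn_ord q.
(* both indices are shifts, by q and by p, of the same place *)
have -> : (s + M = q + (s + (M - q)))%N by rewrite addnCA subnKC // ltnW.
have -> : (s + (M + p - q) = p + (s + (M - q)))%N.
  by rewrite addnCA addnC [(p + _)%N]addnC -addnBAC ?(ltnW qM) // addnC.
by apply: aphi; move: pI qI; rewrite !inE => /eqP -> /eqP ->.
Qed.

End blocks.

(** * Averages against oscillating sequences *)

Section disjointness.
Context {R : realType}.
Local Open Scope classical_set_scope.
Local Open Scope ring_scope.
Implicit Types (c u v : nat -> R[i]) (eps t : R).

Lemma cvg0_normc u : u @ \oo --> (0 : R[i]) <->
  forall e : R, 0 < e -> \forall N \near \oo, normc (u N) <= e.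
Proof.
split=> [/cvgr0Pnorm_le H e e0|H].
  have : 0 < e%:C%C :> R[i] by rewrite ltcR.
  by move=> /H; apply: filterS => N; rewrite normc_norm lecR.
apply/cvgr0Pnorm_le => -[e e'] /=; rewrite ltcE /= => /andP[/eqP -> e0].
by have Hu := H e e0; apply: filterS Hu => N; rewrite normc_norm lecR.
Qed.

Definition mean_null v : Prop :=
  forall e : R, 0 < e -> \forall N \near \oo, normc (average v N) <= e.

Lemma averageD u v N : average (fun n => u n + v n) N = average u N + average v N.
Proof. by rewrite /average big_split mulrDr. Qed.

Lemma averageZ (z : R[i]) u N : average (fun n => z * u n) N = z * average u N.
Proof. by rewrite /average -mulr_sumr mulrCA. Qed.

Lemma mean_nullD u v : mean_null u -> mean_null v -> mean_null (fun n => u n + v n).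
Proof.
move=> nu nv e e0; have e2 : 0 < e / 2 by lra.
near=> N; rewrite averageD (splitr e); apply: le_trans (le_normcD _ _) _.
by apply: lerD; near: N; [exact: nu|exact: nv].
Unshelve. all: by end_near. Qed.

Lemma mean_nullZ (z : R[i]) u : mean_null u -> mean_null (fun n => z * u n).
Proof.
move=> nu e e0; have e1 : 0 < e / (normc z + 1).
  by rewrite divr_gt0 // ltr_wpDl ?normc_ge0.
near=> N; rewrite averageZ ComplexField.Normc.normcM.
apply: (@le_trans _ _ ((normc z + 1) * (e / (normc z + 1)))).
  by rewrite ler_pM ?normc_ge0 ?lerDl //; near: N; exact: nu.
by rewrite mulrC divfK // gt_eqF // ltr_wpDl ?normc_ge0.
Unshelve. all: by end_near. Qed.

(** Characters at all real frequencies reduce to those of the definition of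
    [oscillating], because e(n x) depends only on x modulo 1. *)
Lemma oscillating_phase c t : oscillating c ->
  mean_null (fun n => c n * phase (n%:R * t)).
Proof.
move=> osc; apply/cvg0_normc.
pose t' : R := - t - (Num.floor (- t))%:~R.
have t'01 : 0 <= t' < 1 by have := floor_itv (- t); rewrite intrD1 /t'; lra.
suff -> : (fun n => c n * phase (n%:R * t)) =
    fun n => c n * expi (- (2 * pi * n%:R * t')) by exact: osc.
apply/funext => n; congr (_ * _); rewrite -[LHS]mulr1.
(* n times the floor is an integer, whose phase is 1 *)
rewrite -(phase_int (n%:Z * Num.floor (- t))) -phaseD intrM -pmulrn.
by rewrite /phase /t'; congr expi; ring.
Qed.

Lemma oscillating_trig c l : oscillating c -> mean_null (fun n => c n * trig l n).
Proof.
move=> osc; elim: l => [|w l IH].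
  move=> e e0; near=> N; rewrite /average big1 => [|n _].
    by rewrite mulr0 ComplexField.Normc.normc0 ltW.
  by rewrite /trig big_nil mulr0.
have -> : (fun n => c n * trig (w :: l) n) =
    fun n => w.1 * (c n * phase (n%:R * w.2)) + c n * trig l n.
  by apply/funext => n; rewrite /trig big_cons; ring.
apply: mean_nullD => //; apply: mean_nullZ; exact: oscillating_phase.
Unshelve. all: by end_near. Qed.

(** x <= 1 + x^lambda for x >= 0, since x <= x^lambda when x >= 1. *)
Lemma growth_mean_bounded c (lambda : R) :
  1 < lambda -> growth_condition c lambda ->
  exists2 C : R, 0 < C &
    \forall N \near \oo, \sum_(1 <= n < N.+1) normc (c n) <= C * N%:R.
Proof.
move=> l1 /eqOP[k [_ /(_ (`|k| + 1))]].
have kk : k < `|k| + 1 by rewrite ltr_pwDr // ler_norm.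
move=> /(_ kk) H; exists (`|k| + 1 + 1); first by rewrite ltr_wpDl // addr_ge0.
apply: filterS H => N; rewrite [`|N%:R|]ger0_norm // => H.
apply: (@le_trans _ _ (\sum_(1 <= n < N.+1) (normc (c n) `^ lambda + 1))).
  apply: ler_sum => n _; have [n1|n1] := leP (normc (c n)) 1.
    by rewrite (le_trans n1) // lerDr powR_ge0.
  rewrite ler_wpDr // -{1}[normc (c n)]powRr1 ?normc_ge0 //.
  by rewrite ler_powR ?ltW.
rewrite big_split /= sumr_const_nat subSS subn0 mulrDl mul1r lerD //.
exact: le_trans (ler_norm _) H.
Qed.

(** The finitely many terms where [v] is not yet small contribute at most K/N,
    the others at most eps. *)
Lemma mean_null_small c (C eps : R) v : 0 < C -> 0 < eps ->
  (\forall N \near \oo, \sum_(1 <= n < N.+1) normc (c n) <= C * N%:R) ->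
  (\forall n \near \oo, normc (v n) <= eps / C) ->
  \forall N \near \oo, normc (average (fun n => c n * v n) N) <= 2 * eps.
Proof.
move=> C0 e0 cC [n0 _ vn0].
pose K := \sum_(1 <= n < n0.+1) normc (c n * v n).
have K0 : 0 <= K by apply: sumr_ge0 => n _; exact: normc_ge0.
near=> N.
have N0 : 0 < N%:R :> R by rewrite ltr0n; near: N; exact: nbhs_infty_gt.
rewrite /average ComplexField.Normc.normcM ComplexField.Normc.normcV normc_nat.
rewrite ler_pdivrMl //; apply: le_trans (normc_sum _ _ _) _.
have n0N : (n0 <= N)%N by near: N; exact: nbhs_infty_ge.
have cN : \sum_(1 <= n < N.+1) normc (c n) <= C * N%:R by near: N.
have KN : K <= eps * N%:R.
  rewrite -ler_pdivrMl //; near: N; exact: nbhs_infty_ger.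
have : \sum_(1 <= n < N.+1) normc (c n * v n) <=
    K + \sum_(1 <= n < N.+1) normc (c n) * (eps / C).
  rewrite (@big_cat_nat _ _ _ n0.+1) //= -/K lerD2l.
  rewrite [leRHS](@big_cat_nat _ _ _ n0.+1) //= ler_wpDl //.
    by apply: sumr_ge0 => n _; rewrite mulr_ge0 ?normc_ge0 // ltW // divr_gt0.
  apply: ler_sum_nat => n /andP[n0n _]; rewrite ComplexField.Normc.normcM.
  by rewrite ler_wpM2l ?normc_ge0 // vn0 //= ltnW.
rewrite -mulr_suml => /le_trans; apply.
have : (\sum_(1 <= n < N.+1) normc (c n)) * (eps / C) <= eps * N%:R.
  rewrite mulrA ler_pdivrMr // mulrC -mulrA ler_pM2l // mulrC //.
lra.
Unshelve. all: by end_near. Qed.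

Lemma disjoint_precompact c (lambda : R) a : oscillating c -> 1 < lambda ->
  growth_condition c lambda -> precompact_shifts a ->
  average (fun n => c n * a n) @ \oo --> (0 : R[i]).
Proof.
move=> osc l1 /(growth_mean_bounded l1)[C C0 cC] pa; apply/cvg0_normc => e e0.
have e3 : 0 < e / 3 by lra.
have [|l al] := @bohr_approximation _ a (e / 3 / C) pa; first by rewrite divr_gt0.
have small := mean_null_small C0 e3 cC al.
have null := oscillating_trig l osc e3.
near=> N.
have -> : average (fun n => c n * a n) N =
    average (fun n => c n * (a n - trig l n)) N + average (fun n => c n * trig l n) N.
  by rewrite -averageD; congr (average _ N); apply/funext => n; ring.
apply: le_trans (le_normcD _ _) _; apply: (@le_trans _ _ (2 * (e / 3) + e / 3)).
  by apply: lerD; near: N.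
lra.
Unshelve. all: by end_near. Qed.

End disjointness.

(** * Orbits of equicontinuous flows *)

Section flows.
Local Open Scope classical_set_scope.
Local Open Scope ring_scope.
Context {R : realType} {X : metricType R}.
Implicit Types (T : X -> X) (f : X -> R[i]).

(** Heine's theorem. *)
Lemma uniform_continuity f (e : R) : compact [set: X] -> continuous f -> 0 < e ->
  exists2 d : R, 0 < d & forall x y, mdist x y < d -> normc (f x - f y) <= e.
Proof.
move=> /compact_near_coveringP cX cf e0; have e2 : 0 < e / 2 by lra.
have near_unif : \forall d \near (0 : R)^'+,
    ([set: X] `<=` [set x | forall y, mdist x y < d -> normc (f x - f y) <= e]).
  apply: cX => x _.
  have cfx : (\forall y \near x, normc (f x - f y) <= e / 2).
    have /cvgrPdist_le /(_ (e / 2)%:C%C) := cf x.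
    rewrite ltcR => /(_ e2); apply: filterS => y.
    by rewrite normc_norm lecR.
  move/nbhs_ballP : cfx => [r /= r0 fr].
  have r2 : 0 < r / 2 by lra.
  near=> y d => z /= yz.
  have xy : mdist x y < r / 2.
    by near: y; have := nbhsx_ballx x _ r2; rewrite ballEmdist.
  have dr : d < r / 2 by near: d; exact: nbhs_right_lt.
  rewrite -(subrK (f x) (f y)) -addrA; apply: le_trans (le_normcD _ _) _.
  rewrite (splitr e) lerD //.
    by rewrite normcB; apply: fr; rewrite ballEmdist /=; lra.
  apply: fr; rewrite ballEmdist /=; apply: le_lt_trans (metric_triangle _ y _) _.
  by lra.
have [d [d0 dP]] := filter_ex (filterI (nbhs_right_gt (0 : R)) near_unif).
by exists d => // x y; apply: dP.
Unshelve. all: by end_near. Qed.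

(** A finite net of [X] colours the shifts: two points of the orbit close to the
    same point of the net have close orbits at all later times, by
    equicontinuity, and [f] is uniformly continuous. *)
Lemma precompact_orbit T f x : compact [set: X] -> equicontinuous_flow T ->
  continuous f -> precompact_shifts (fun n => f (iter n T x)).
Proof.
move=> cX equi cf eps e0; have e2 : 0 < eps / 2 by lra.
have [d d0 fd] := uniform_continuity cX cf e2.
have [r r0 Tr] := equi _ d0.
have [y _|l lP] := @compact_finite_cover X _ (fun y => [set z | mdist y z < r]) cX.
  by apply/nbhs_ballP; exists r => //; rewrite ballEmdist.
exists 'I_(size l).+1.
pose near_net (s : nat) y := `[< mdist y (iter s T x) < r >].
(* The colour is the position in the net of the first point close enough. *)
exists (fun s => inord (find (near_net s) l)) => s s' ss' m.
have net n : mdist (nth x l (inord (find (near_net n) l) : 'I_(size l).+1))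
    (iter n T x) < r.
  rewrite inordK ?ltnS ?find_size //.
  have /(nth_find x)/asboolP // : has (near_net n) l.
  by have [y yl yn] := lP (iter n T x) I; apply/hasP; exists y => //; apply/asboolP.
have yr := net s; have zr := net s'; rewrite -ss' in zr.
set y := nth _ _ _ in yr zr.
have close n : mdist y (iter n T x) < r ->
    normc (f (iter m T y) - f (iter (n + m)%N T x)) <= eps / 2.
  by move=> nr; rewrite addnC iterD; apply: fd; exact: Tr.
have -> : f (iter (s + m) T x) - f (iter (s' + m) T x) =
   - (f (iter m T y) - f (iter (s + m)%N T x)) +
   (f (iter m T y) - f (iter (s' + m)%N T x)) by ring.
apply: le_trans (le_normcD _ _) _.
rewrite normcN (splitr eps) lerD //; exact: close.
Qed.

End flows.

Theorem corollary2 (R : realType) (c : nat -> R[i])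
    (c_osc : oscillating c)
    (c_growth : exists2 lambda : R, 1 < lambda & growth_condition c lambda)
    (X : metricType R) (T : X -> X)
    (T_flow : flow T) (T_equi : equicontinuous_flow T) :
  linearly_disjoint c T.
Proof.
case: c_growth => lambda lambda1 growth f cf x.
apply: (disjoint_precompact c_osc lambda1 growth).
exact: precompact_orbit T_flow.1 T_equi cf.
Qed.
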